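(* Let $G\subset GL_d(K)$ be a reductive group and let $W$ be a $G$-submodule of $KX_d$ such that $KX_d=(KX_d)^G\oplus W$. If $K[W]^G\neq K$, then the algebra $F_d({\mathfrak V})^G$ is not finitely generated (as a $K$-algebra) for any variety $\mathfrak V$ containing $\mathfrak L$.
   Context: $K$ is a field of characteristic $0$, $d\ge 2$ is an integer, and algebras are $K$-algebras, not necessarily associative or unital. A variety is the class of all algebras satisfying a given set of polynomial identities (elements of the absolutely free nonassociative algebra $K\{x_1,x_2,\ldots\}$). For a variety $\mathfrak V$, $F_d(\mathfrak V)$ is the relatively free algebra of $\mathfrak V$ of rank $d$, freely generated by $X_d=\{x_1,\ldots,x_d\}$, i.e. $K\{x_1,\ldots,x_d\}$ (without constant terms) modulo the polynomial identities of $\mathfrak V$ in $x_1,\ldots,x_d$. $\mathfrak L$ is the variety of algebras defined by the right-symmetric identity $(x_1,x_2,x_3)=(x_1,x_3,x_2)$, where $(x_1,x_2,x_3)=x_1(x_2x_3)-(x_1x_2)x_3$, together with $x_1(x_2x_3)=0$. $GL_d(K)$ acts canonically on the vector space $KX_d$ with basis $X_d$, and this action is extended to $F_d(\mathfrak V)$ and to $K[X_d]=K[x_1,\ldots,x_d]$ by $g(f(x_1,\ldots,x_d))=f(g(x_1),\ldots,g(x_d))$. The superscript $G$ denotes the set of elements fixed by all $g\in G$. For a subspace $W\subseteq KX_d$, $K[W]$ denotes the unital subalgebra of $K[X_d]$ generated by $W$ (equivalently, the symmetric algebra of $W$). For a reductive group $G\subset GL_d(K)$ a $G$-submodule $W$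 with $KX_d=(KX_d)^G\oplus W$ always exists. *)

(* Defs.v *)
From HB Require Import structures.
From mathcomp Require Import all_boot all_order all_algebra.
From mathcomp Require Import boolp classical_sets.
From mathcomp Require Import finmap monalg.

Set Implicit Arguments.
Unset Strict Implicit.
Unset Printing Implicit Defensive.

Import GRing.Theory.
Local Open Scope ring_scope.
Local Open Scope quotient_scope.

Reserved Notation "x ** y" (at level 40, left associativity).

HB.mixin Record Lmodule_isNAAlgebra (K : fieldType) A of GRing.Lmodule K A := {
  namul : A -> A -> A;
  namulDl : left_distributive namul +%R;
  namulDr : right_distributive namul +%R;
  namulZl : forall (a : K) (x y : A), namul (a *: x) y = a *: namul x y;
  namulZr : forall (a : K) (x y : A), namul x (a *: y) = a *: namul x y
}.

#[short(type="naAlgType")]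
HB.structure Definition NAAlgebra (K : fieldType) :=
  {A of GRing.Lmodule K A & Lmodule_isNAAlgebra K A}.

Notation "x ** y" := (namul x y) : ring_scope.

Section NAAlgebraTheory.
Context {K : fieldType} {A : naAlgType K}.
Implicit Types x y z : A.

Definition associator x y z : A := x ** (y ** z) - (x ** y) ** z.

Lemma namul0l y : 0 ** y = 0 :> A.
Proof. by have := namulZl 0 0 y; rewrite !scale0r. Qed.

Lemma namul0r x : x ** 0 = 0 :> A.
Proof. by have := namulZr 0 x 0; rewrite !scale0r. Qed.

Lemma namul_suml I (r : seq I) (F : I -> A) y :
  (\sum_(i <- r) F i) ** y = \sum_(i <- r) F i ** y.
Proof. exact: (big_morph (namul^~ y) (fun a b => namulDl a b y) (namul0l y)). Qed.

Lemma namul_sumr I (r : seq I) (F : I -> A) x :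
  x ** (\sum_(i <- r) F i) = \sum_(i <- r) x ** F i.
Proof. exact: (big_morph (namul x) (namulDr x) (namul0r x)). Qed.

Definition na_subalgebra (B : set A) : Prop :=
  [/\ B 0, (forall x y, B x -> B y -> B (x + y)),
      (forall (a : K) x, B x -> B (a *: x))
    & (forall x y, B x -> B y -> B (x ** y))].

Definition na_generated (S : set A) : set A :=
  [set x | forall B : set A, na_subalgebra B -> (S `<=` B)%classic -> B x].

Definition na_finitely_generated (B : set A) : Prop :=
  exists s : seq A, B = na_generated [set` s].

End NAAlgebraTheory.

Inductive nmonom (X : Type) : Type :=
  | NVar of X
  | NMul of nmonom X & nmonom X.

Section NMonomChoice.
Variable X : Type.

Fixpoint nmonom_encode (m : nmonom X) : GenTree.tree X :=
  match m with
  | NVar x => GenTree.Leaf x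
  | NMul m1 m2 => GenTree.Node 0 [:: nmonom_encode m1; nmonom_encode m2]
  end.

Fixpoint nmonom_decode (t : GenTree.tree X) : option (nmonom X) :=
  match t with
  | GenTree.Leaf x => Some (NVar x)
  | GenTree.Node _ [:: t1; t2] =>
      if (nmonom_decode t1, nmonom_decode t2) is (Some m1, Some m2)
      then Some (NMul m1 m2) else None
  | _ => None
  end.

Lemma nmonom_encodeK : pcancel nmonom_encode nmonom_decode.
Proof. by elim=> //= m1 -> m2 ->. Qed.

End NMonomChoice.

HB.instance Definition _ (X : choiceType) :=
  Choice.copy (nmonom X) (pcan_type (@nmonom_encodeK X)).

(* The absolutely free nonassociative algebra (without unit) on X. *)
Definition nafree (K : fieldType) (X : choiceType) := {malg K[nmonom X]}.

HB.instance Definition _ (K : fieldType) (X : choiceType) :=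
  Choice.on (nafree K X).

(* The operations of {malg K[nmonom X]} are sealed: conversion checks that    *)
(* unfold them down to finite maps do not terminate in reasonable time.       *)
HB.lock Definition nafree_zero (K : fieldType) (X : choiceType) :
  nafree K X := (0 : {malg K[nmonom X]}).
HB.lock Definition nafree_opp (K : fieldType) (X : choiceType)
  (p : {malg K[nmonom X]}) : nafree K X := - p.
HB.lock Definition nafree_add (K : fieldType) (X : choiceType)
  (p q : {malg K[nmonom X]}) : nafree K X := p + q.
HB.lock Definition nafree_scale (K : fieldType) (X : choiceType)
  (a : K) (p : {malg K[nmonom X]}) : nafree K X := a *: p.
HB.lock Definition namon (K : fieldType) (X : choiceType) (m : nmonom X) :
  nafree K X := (<< m >> : {malg K[nmonom X]}).

Arguments namon : clear implicits.

Section NAFreeLmodule.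
Variables (K : fieldType) (X : choiceType).
Local Notation F := (nafree K X).
Local Notation add := (@nafree_add K X : F -> F -> F).
Local Notation scale := (@nafree_scale K X : K -> F -> F).

Fact nafree_addA : associative add.
Proof. by move=> p q r; rewrite !nafree_add.unlock addrA. Qed.

Fact nafree_addC : commutative add.
Proof. by move=> p q; rewrite !nafree_add.unlock addrC. Qed.

Fact nafree_add0 : left_id (nafree_zero K X) add.
Proof. by move=> p; rewrite nafree_add.unlock nafree_zero.unlock add0r. Qed.

Fact nafree_addN : left_inverse (nafree_zero K X) (@nafree_opp K X : F -> F) add.
Proof.
by move=> p; rewrite nafree_add.unlock nafree_zero.unlock nafree_opp.unlock addNr.
Qed.

HB.instance Definition _ := GRing.isZmodule.Build F
  nafree_addA nafree_addC nafree_add0 nafree_addN.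

Fact nafree_scaleA a b p : scale a (scale b p) = scale (a * b) p.
Proof. by rewrite nafree_scale.unlock scalerA. Qed.

Fact nafree_scale1 : left_id 1 scale.
Proof. by move=> p; rewrite nafree_scale.unlock scale1r. Qed.

Lemma nafree_addE (p q : F) : p + q = (p : {malg K[nmonom X]}) + q.
Proof. by rewrite [LHS]/GRing.add /= nafree_add.unlock. Qed.

Fact nafree_scaleDr : right_distributive scale +%R.
Proof. by move=> a p q; rewrite !nafree_addE nafree_scale.unlock scalerDr. Qed.

Fact nafree_scaleDl p : {morph scale^~ p : a b / a + b}.
Proof. by move=> a b; rewrite nafree_addE nafree_scale.unlock scalerDl. Qed.

HB.instance Definition _ := GRing.Zmodule_isLmodule.Build K F
  nafree_scaleA nafree_scale1 nafree_scaleDr nafree_scaleDl.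

Lemma nafree_scaleE a (p : F) : a *: p = a *: (p : {malg K[nmonom X]}).
Proof. by rewrite [LHS]/GRing.scale /= nafree_scale.unlock. Qed.

Lemma nacoefD m (p q : F) : (p + q)@_m = p@_m + q@_m.
Proof. by rewrite nafree_addE mcoeffD. Qed.

Lemma nacoefZ m a (p : F) : (a *: p)@_m = a * p@_m.
Proof. by rewrite nafree_scaleE mcoeffZ. Qed.

Lemma nacoef0 m : (0 : F)@_m = 0.
Proof. by rewrite [0 : F]/GRing.zero /= nafree_zero.unlock mcoeff0. Qed.

Lemma nacoef_mon m n : (namon K X m)@_n = (m == n)%:R.
Proof. by rewrite namon.unlock mcoeffU. Qed.

Lemma nacoef_sum n I (r : seq I) (G : I -> F) :
  (\sum_(i <- r) G i)@_n = \sum_(i <- r) (G i)@_n.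
Proof. exact: (big_morph (mcoeff n) (nacoefD n) (nacoef0 n)). Qed.

Lemma nafree_sumE (p : F) : p = \sum_(m <- msupp p) p@_m *: namon K X m.
Proof.
apply/malgP => n; rewrite nacoef_sum {1}[p]monalgE raddf_sum.
apply: eq_bigr => m _ /=.
by rewrite nacoefZ nacoef_mon mcoeffU mulr_natr.
Qed.

Lemma msupp_addS (p q : F) : (msupp (p + q) `<=` msupp p `|` msupp q)%fset.
Proof. by rewrite nafree_addE msuppD_le. Qed.

Lemma msupp_scaleS a (p : F) : (msupp (a *: p) `<=` msupp p)%fset.
Proof. by rewrite nafree_scaleE msuppZ_le. Qed.

End NAFreeLmodule.

(* The linear extension to nafree K X of a map h defined on monomials. *)
HB.lock Definition nalin (K : fieldType) (X : choiceType) (A : lmodType K)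
    (h : nmonom X -> A) (p : nafree K X) : A :=
  \sum_(m <- msupp p) p@_m *: h m.

Lemma nalinE (K : fieldType) (X : choiceType) (A : lmodType K)
    (h : nmonom X -> A) (p : nafree K X) :
  nalin h p = \sum_(m <- msupp p) p@_m *: h m.
Proof. by rewrite nalin.unlock. Qed.

Section NAFree.
Variables (K : fieldType) (X : choiceType).
Local Notation F := (nafree K X).
Implicit Types (p q : F) (m n : nmonom X).

Section Eval.
Variables (A : lmodType K) (h : nmonom X -> A).

Local Notation nalin := (nalin h).

Lemma nalinEw (D : {fset nmonom X}) p :
  (msupp p `<=` D)%fset -> nalin p = \sum_(m <- D) p@_m *: h m.
Proof.
move=> sD; rewrite nalinE (big_fset_incl _ sD) //= => m _ /mcoeff_outdom ->.
by rewrite scale0r.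
Qed.

Lemma nalinD p q : nalin (p + q) = nalin p + nalin q.
Proof.
have sp : (msupp p `<=` msupp p `|` msupp q)%fset by rewrite fsubsetUl.
have sq : (msupp q `<=` msupp p `|` msupp q)%fset by rewrite fsubsetUr.
rewrite (nalinEw sp) (nalinEw sq) (nalinEw (msupp_addS p q)) -big_split /=.
by apply: eq_bigr => m _; rewrite nacoefD scalerDl.
Qed.

Lemma nalinZ a p : nalin (a *: p) = a *: nalin p.
Proof.
rewrite (nalinEw (msupp_scaleS a p)) [nalin p]nalinE scaler_sumr.
by apply: eq_bigr => m _; rewrite nacoefZ scalerA.
Qed.

Lemma nalin_mon m : nalin (namon K X m) = h m.
Proof.
rewrite namon.unlock.
by rewrite (nalinEw msuppU_le) big_seq_fset1 mcoeffUU scale1r. Qed.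

Lemma nalin0 : nalin 0 = 0.
Proof. by have := nalinZ 0 0; rewrite !scale0r. Qed.

Lemma nalinB p q : nalin (p - q) = nalin p - nalin q.
Proof. by rewrite -[- q]scaleN1r nalinD nalinZ scaleN1r. Qed.

Lemma nalin_sum I (r : seq I) (G : I -> F) :
  nalin (\sum_(i <- r) G i) = \sum_(i <- r) nalin (G i).
Proof. exact: (big_morph nalin nalinD nalin0). Qed.

End Eval.

Definition nafree_mul p q : F :=
  nalin (fun m => nalin (fun n => namon K X (NMul m n)) q) p.

Lemma nalin_addh (A : lmodType K) (h1 h2 : nmonom X -> A) p :
  nalin (fun m => h1 m + h2 m) p = nalin h1 p + nalin h2 p.
Proof.
by rewrite !nalinE -big_split; apply: eq_bigr => m _; rewrite /= scalerDr.
Qed.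

Lemma nalin_scaleh (A : lmodType K) (h : nmonom X -> A) a p :
  nalin (fun m => a *: h m) p = a *: nalin h p.
Proof.
rewrite !nalinE scaler_sumr; apply: eq_bigr => m _.
by rewrite !scalerA mulrC.
Qed.

Lemma nalin_eqh (A : lmodType K) (h1 h2 : nmonom X -> A) p :
  h1 =1 h2 -> nalin h1 p = nalin h2 p.
Proof. by move=> e; rewrite !nalinE; apply: eq_bigr => m _; rewrite e. Qed.

Lemma nafree_mulDl : left_distributive nafree_mul +%R.
Proof. by move=> p q r; rewrite /nafree_mul nalinD. Qed.

Lemma nafree_mulDr : right_distributive nafree_mul +%R.
Proof.
move=> p q r; rewrite /nafree_mul -nalin_addh.
by apply: nalin_eqh => m; rewrite nalinD.
Qed.

Lemma nafree_mulZl a p q : nafree_mul (a *: p) q = a *: nafree_mul p q.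
Proof. by rewrite /nafree_mul nalinZ. Qed.

Lemma nafree_mulZr a p q : nafree_mul p (a *: q) = a *: nafree_mul p q.
Proof.
by rewrite /nafree_mul -nalin_scaleh; apply: nalin_eqh => m; rewrite nalinZ.
Qed.

HB.instance Definition _ := Lmodule_isNAAlgebra.Build K F
  nafree_mulDl nafree_mulDr nafree_mulZl nafree_mulZr.

Definition navar (x : X) : F := namon K X (NVar x).

Fixpoint nmonom_eval (A : naAlgType K) (v : X -> A) (m : nmonom X) : A :=
  match m with
  | NVar x => v x
  | NMul m1 m2 => nmonom_eval v m1 ** nmonom_eval v m2
  end.

(* The value of the nonassociative polynomial p at the point v. *)
Definition naeval (A : naAlgType K) (v : X -> A) (p : F) : A :=
  nalin (nmonom_eval v) p.

Section EvalTheory.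
Variables (A : naAlgType K) (v : X -> A).

Lemma naevalE p : naeval v p = \sum_(m <- msupp p) p@_m *: nmonom_eval v m.
Proof. exact: nalinE. Qed.

Lemma naevalD p q : naeval v (p + q) = naeval v p + naeval v q.
Proof. exact: nalinD. Qed.

Lemma naevalB p q : naeval v (p - q) = naeval v p - naeval v q.
Proof. exact: nalinB. Qed.

Lemma naevalZ a p : naeval v (a *: p) = a *: naeval v p.
Proof. exact: nalinZ. Qed.

Lemma naeval0 : naeval v 0 = 0.
Proof. exact: nalin0. Qed.

Lemma naeval_var x : naeval v (navar x) = v x.
Proof. exact: nalin_mon. Qed.

Lemma naeval_comp (h : nmonom X -> F) p :
  naeval v (nalin h p) = nalin (fun m => naeval v (h m)) p.
Proof.
rewrite [nalin h p]nalinE [RHS]nalinE /naeval nalin_sum; apply: eq_bigr => m _.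
exact: nalinZ.
Qed.

Lemma naevalM p q : naeval v (p ** q) = naeval v p ** naeval v q.
Proof.
rewrite naeval_comp {1}nalinE [naeval v p]naevalE namul_suml.
apply: eq_bigr => m _; rewrite namulZl naeval_comp; congr (_ *: _).
rewrite [LHS]nalinE [naeval v q]naevalE namul_sumr; apply: eq_bigr => n _.
by rewrite namulZr /naeval nalin_mon.
Qed.

End EvalTheory.
End NAFree.

Lemma naeval_subst (K : fieldType) (X Y : choiceType) (A : naAlgType K)
    (w : Y -> A) (v : X -> nafree K Y) (p : nafree K X) :
  naeval w (naeval v p) = naeval (fun x => naeval w (v x)) p.
Proof.
rewrite [naeval v p]naevalE [RHS]naevalE (big_morph _ (naevalD w) (naeval0 w)).
apply: eq_bigr => m _; rewrite naevalZ; congr (_ *: _).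
by elim: m => //= m1 <- m2 <-; rewrite naevalM.
Qed.

Definition satisfies (K : fieldType) (I : set (nafree K nat)) (A : naAlgType K)
    : Prop :=
  forall p, I p -> forall v : nat -> A, naeval v p = 0.

Definition is_variety (K : fieldType) (V : naAlgType K -> Prop) : Prop :=
  exists I : set (nafree K nat), forall A, V A <-> satisfies I A.

Definition L_identities (K : fieldType) : set (nafree K nat) :=
  let x := @navar K nat in
  [set associator (x 0%N) (x 1%N) (x 2%N) - associator (x 0%N) (x 2%N) (x 1%N);
       x 0%N ** (x 1%N ** x 2%N)]%classic.

Definition varietyL (K : fieldType) : naAlgType K -> Prop :=
  satisfies (@L_identities K).

Section RelativelyFree.
Variables (K : fieldType) (V : naAlgType K -> Prop) (X : choiceType).
Local Notation F := (nafree K X).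

(* The polynomial identities of V in the variables X. *)
Definition identities_of : pred F :=
  fun p => `[< forall A : naAlgType K, V A ->
               forall v : X -> A, naeval v p = 0 >].

Lemma identities_of_zmod_closed : zmod_closed identities_of.
Proof.
split=> [|p q /asboolP Ip /asboolP Iq]; apply/asboolP => A VA v.
  exact: naeval0.
by rewrite naevalB Ip // Iq // subr0.
Qed.

HB.instance Definition _ :=
  GRing.isZmodClosed.Build F identities_of identities_of_zmod_closed.

Definition relfree := Quotient.quot (GRing.ZmodClosed.clone F identities_of _).

HB.instance Definition _ := GRing.Zmodule.on relfree.
HB.instance Definition _ := EqQuotient.on relfree.

(* Locked, so that unification does not unfold the quotient construction.    *)
Definition relfree_pi : F -> relfree := locked (\pi_relfree : F -> relfree).
Definition relfree_repr : relfree -> F := locked (@repr _ relfree).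

Local Notation cls := relfree_pi.
Local Notation rep := relfree_repr.

Lemma relfree_reprK x : cls (rep x) = x.
Proof. by rewrite /cls /rep -!lock reprK. Qed.

Lemma relfreeW (P : relfree -> Prop) : (forall p, P (cls p)) -> forall x, P x.
Proof. by move=> Pp x; rewrite -[x]relfree_reprK. Qed.

Lemma relfree_eqP (p q : F) :
  (forall A : naAlgType K, V A -> forall v : X -> A, naeval v p = naeval v q)
    <-> cls p = cls q.
Proof.
rewrite /cls -lock; split=> [e|/eqP].
  apply/eqP; rewrite -Quotient.idealrBE; apply/asboolP => A VA v.
  by rewrite naevalB e // subrr.
rewrite -Quotient.idealrBE => /asboolP e A VA v.
by apply/eqP; rewrite -subr_eq0 -naevalB e.
Qed.

Lemma naeval_repr (A : naAlgType K) (v : X -> A) (p : F) :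
  V A -> naeval v (rep (cls p)) = naeval v p.
Proof. by move=> VA; apply: (relfree_eqP _ _).2 => //; rewrite relfree_reprK. Qed.

Lemma relfree_piD (p q : F) : cls (p + q) = cls p + cls q.
Proof. by rewrite /cls -lock !piE. Qed.

Lemma relfree_pi0 : cls 0 = 0.
Proof. by rewrite /cls -lock !piE. Qed.

Definition relfree_scale (a : K) (x : relfree) : relfree := cls (a *: rep x).
Definition relfree_mul (x y : relfree) : relfree := cls (rep x ** rep y).

Lemma relfree_piZ_def a (p : F) : cls (a *: p) = relfree_scale a (cls p).
Proof. by apply/relfree_eqP => A VA v; rewrite !naevalZ naeval_repr. Qed.

Lemma relfree_piM_def (p q : F) : cls (p ** q) = relfree_mul (cls p) (cls q).
Proof. by apply/relfree_eqP => A VA v; rewrite !naevalM !naeval_repr. Qed.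

Lemma relfree_scaleA a b x :
  relfree_scale a (relfree_scale b x) = relfree_scale (a * b) x.
Proof. by elim/relfreeW: x => p; rewrite -!relfree_piZ_def scalerA. Qed.

Lemma relfree_scale1 : left_id 1 relfree_scale.
Proof. by elim/relfreeW => p; rewrite -relfree_piZ_def scale1r. Qed.

Lemma relfree_scaleDr : right_distributive relfree_scale +%R.
Proof.
move=> a; elim/relfreeW => p; elim/relfreeW => q.
by rewrite -relfree_piD -!relfree_piZ_def -relfree_piD scalerDr.
Qed.

Lemma relfree_scaleDl x : {morph relfree_scale^~ x : a b / a + b}.
Proof.
move=> a b; elim/relfreeW: x => p.
by rewrite -!relfree_piZ_def -relfree_piD scalerDl.
Qed.

HB.instance Definition _ := GRing.Zmodule_isLmodule.Build K relfree
  relfree_scaleA relfree_scale1 relfree_scaleDr relfree_scaleDl.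

Lemma relfree_piZ a (p : F) : cls (a *: p) = a *: cls p.
Proof. exact: relfree_piZ_def. Qed.

Lemma relfree_mulDl : left_distributive relfree_mul +%R.
Proof.
elim/relfreeW => p; elim/relfreeW => q; elim/relfreeW => r.
by rewrite -relfree_piD -!relfree_piM_def -relfree_piD namulDl.
Qed.

Lemma relfree_mulDr : right_distributive relfree_mul +%R.
Proof.
elim/relfreeW => p; elim/relfreeW => q; elim/relfreeW => r.
by rewrite -relfree_piD -!relfree_piM_def -relfree_piD namulDr.
Qed.

Lemma relfree_mulZl a x y : relfree_mul (a *: x) y = a *: relfree_mul x y.
Proof.
elim/relfreeW: x => p; elim/relfreeW: y => q.
by rewrite -relfree_piZ -!relfree_piM_def -relfree_piZ namulZl.
Qed.

Lemma relfree_mulZr a x y : relfree_mul x (a *: y) = a *: relfree_mul x y.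
Proof.
elim/relfreeW: x => p; elim/relfreeW: y => q.
by rewrite -relfree_piZ -!relfree_piM_def -relfree_piZ namulZr.
Qed.

HB.instance Definition _ := Lmodule_isNAAlgebra.Build K relfree
  relfree_mulDl relfree_mulDr relfree_mulZl relfree_mulZr.

Lemma relfree_piM (p q : F) : cls (p ** q) = cls p ** cls q.
Proof. exact: relfree_piM_def. Qed.

Definition relvar (x : X) : relfree := cls (navar K x).

Lemma naeval_pi (Y : choiceType) (v : Y -> F) (p : nafree K Y) :
  naeval (cls \o v) p = cls (naeval v p).
Proof.
rewrite [LHS]naevalE [naeval v p]naevalE (big_morph cls relfree_piD relfree_pi0).
apply: eq_bigr => m _; rewrite relfree_piZ; congr (_ *: _).
by elim: m => //= m1 -> m2 ->; rewrite relfree_piM.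
Qed.

(* Evaluation at points of relfree factors through relfree. *)
Lemma naeval_repr_relfree (v : X -> relfree) (p : F) :
  naeval v (rep (cls p)) = naeval v p.
Proof.
have -> : v = cls \o (rep \o v) by apply/funext => x /=; rewrite relfree_reprK.
rewrite !naeval_pi; apply/relfree_eqP => A VA w.
by rewrite !naeval_subst naeval_repr.
Qed.

Lemma naeval_relvar (p : F) : naeval relvar p = cls p.
Proof.
rewrite -[relvar]/(cls \o @navar K X) naeval_pi; congr (cls _).
rewrite naevalE [RHS]nafree_sumE; apply: eq_bigr => m _; congr (_ *: _).
elim: m => //= m1 -> m2 ->.
by rewrite /namul /= /nafree_mul !nalin_mon.
Qed.

End RelativelyFree.

Lemma relfree_in_variety (K : fieldType) (V : naAlgType K -> Prop)
    (X : choiceType) : is_variety V -> V (relfree V X).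
Proof.
case=> I VI; apply/VI => p Ip v.
pose w := @relfree_repr K V X \o v.
have e : @relfree_pi K V X \o w = v.
  by apply/funext => x /=; rewrite relfree_reprK.
have := @naeval_pi K V X nat w p; rewrite e => ->.
rewrite -(relfree_pi0 V X); apply/relfree_eqP => A VA u.
by rewrite naeval_subst naeval0; move/VI: VA; apply.
Qed.

From mathcomp Require Import mpoly.
(* monalg has its own notation for polynomials. *)
Local Notation "{ 'mpoly' T [ n ] }" := (mpoly.mpoly n T) : type_scope.

Section LinearGroups.
Variables (K : fieldType) (d : nat).
Implicit Types (G N Z : set 'M[K]_d) (g : 'M[K]_d) (W : {vspace 'cV[K]_d}).

Local Open Scope classical_set_scope.

Definition matrix_group G : Prop :=
  [/\ G `<=` [set g | g \in unitmx], G 1%:M,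
      forall g h, G g -> G h -> G (g *m h)
    & forall g, G g -> G (invmx g)].

(* Closed subsets of GL_d(K); allowing det^-1 in the equations would give the *)
(* same sets.                                                                 *)
Definition zariski_closed Z : Prop :=
  exists P : set {mpoly K[(d * d)%N]},
    Z = [set g | g \in unitmx /\ forall p, P p -> p.@[mxvec g 0] = 0].

Definition zariski_connected Z : Prop :=
  forall Z1 Z2, zariski_closed Z1 -> zariski_closed Z2 ->
    Z = Z1 `|` Z2 -> Z1 `&` Z2 = set0 -> Z1 = set0 \/ Z2 = set0.

Definition unipotent g : Prop := exists n, (g - 1%:M) ^+ n = 0.

Definition normal_in N G : Prop :=
  N `<=` G /\ forall g n, G g -> N n -> N (g *m n *m invmx g).

(* A linear algebraic group with trivial unipotent radical. In characteristic *)
(* 0 the unipotent radical of the Zariski closure of G over an algebraic      *)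
(* closure of K is defined over K and its K-points are dense, so it can be    *)
(* tested on the closed subgroups of GL_d(K).                                 *)
Definition reductive G : Prop :=
  [/\ matrix_group G, zariski_closed G
    & forall N, matrix_group N -> zariski_closed N -> zariski_connected N ->
        normal_in N G -> N `<=` unipotent -> N = [set 1%:M]].

(* The space KX_d is 'cV[K]_d, the column v standing for \sum_i v_i x_i; thus *)
(* g(x_j) = \sum_i g_ij x_i, and g acts on KX_d by v |-> g *m v.              *)
Definition fixed_vectors G : set 'cV[K]_d :=
  [set v | forall g, G g -> g *m v = v].

Definition submodule G W : Prop :=
  forall g w, G g -> w \in W -> g *m w \in W.

Definition complement_of_fixed G W : Prop :=
  (forall v, exists u w, [/\ fixed_vectors G u, w \in W & v = u + w])
  /\ fixed_vectors G `&` [set` W] = [set 0].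

Definition linform (v : 'cV[K]_d) : {mpoly K[d]} := \sum_i v i 0 *: 'X_i.

Definition poly_act g (f : {mpoly K[d]}) : {mpoly K[d]} :=
  f \mPo [tuple linform (col j g) | j < d].

Definition unital_subalgebra (B : set {mpoly K[d]}) : Prop :=
  [/\ B 1, (forall f h, B f -> B h -> B (f + h)),
      (forall (a : K) f, B f -> B (a *: f))
    & (forall f h, B f -> B h -> B (f * h))].

(* K[W] *)
Definition poly_algebra W : set {mpoly K[d]} :=
  [set f | forall B, unital_subalgebra B -> linform @` [set` W] `<=` B -> B f].

(* K[W]^G *)
Definition poly_invariants G W : set {mpoly K[d]} :=
  poly_algebra W `&` [set f | forall g, G g -> poly_act g f = f].

Section RelfreeInvariants.
Variable V : naAlgType K -> Prop.

Definition relfree_linform (v : 'cV[K]_d) : relfree V 'I_d :=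
  \sum_i v i 0 *: relvar V i.

Definition relfree_act g (x : relfree V 'I_d) : relfree V 'I_d :=
  naeval (fun j => relfree_linform (col j g)) (relfree_repr x).

Lemma relfree_act_pi g p :
  relfree_act g (relfree_pi V p) =
    naeval (fun j => relfree_linform (col j g)) p.
Proof. exact: naeval_repr_relfree. Qed.

Lemma relfree_act_linform g v :
  relfree_act g (relfree_linform v) = relfree_linform (g *m v).
Proof.
pose p : nafree K 'I_d := \sum_i v i 0 *: navar K i.
have -> : relfree_linform v = relfree_pi V p.
  rewrite /p (big_morph _ (@relfree_piD K V _) (@relfree_pi0 K V _)).
  by apply: eq_bigr => i _; rewrite relfree_piZ.
rewrite relfree_act_pi /p (big_morph _ (naevalD _) (naeval0 _)).
under eq_bigr do rewrite naevalZ naeval_var scaler_sumr.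
rewrite exchange_big; apply: eq_bigr => i _ /=.
rewrite mxE scaler_suml; apply: eq_bigr => j _.
by rewrite mxE scalerA mulrC.
Qed.

(* F_d(V)^G *)
Definition relfree_invariants G : set (relfree V 'I_d) :=
  [set x | forall g, G g -> relfree_act g x = x].

End RelfreeInvariants.
End LinearGroups.

Arguments relfree_invariants {K d} V G.

(* Main.v *)
Require Import Defs.
From mathcomp Require Import all_boot all_algebra.
From mathcomp Require Import boolp classical_sets mpoly.
From HB Require Import structures.

(** The proof compares [F_d(V)] with one explicit algebra of the variety [L].

    Put on [K[X_d]] the product [p ** q = (p - p(0)) * lin q], where [lin q] is the
    homogeneous component of degree 1 of [q].  A product has neither constant
    nor linear part.  Hence right multiplication by [q] acts on products as
    ordinary multiplication by [lin q], so that any two right multiplications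
    commute there, and it vanishes when [q] is itself a product: this algebra
    lies in [L], hence in every [V] containing [L].  The homomorphism [realize] from
    [F_d(V)] sending [x_i] to [x_i] commutes with all linear substitutions.

    Let [P] be the projection of [KX_d] onto [W] along the fixed vectors, acting
    on [K[X_d]] by substitution.  If [x] and [y] are invariant, then the linear
    part of [realize y] is a fixed vector, so [P] kills it and therefore kills
    [realize (x ** y)].  Consequently, if finitely many elements generate the
    invariants, the polynomials [P (realize x)], [x] invariant, are linear
    combinations of the images of the generators, and their degrees are bounded
    ([fg_invariants_bounded]).

    On the other hand, polarization turns a polynomial [f] into an element
    [polarize n f] of [F_d(V)], the sum over all words [w] of length [n.+1] of
    the left-normed product along [w] with coefficient the value at 0 of the
    derivative of [f] along [w].  By the chain rule it commutes with linear
    substitutions, so it maps invariants to invariants.  Its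
    realization is [(n.+1)!] times the component of degree [n.+1] of [f]
    ([mcoeff_realize_polarize]).  In characteristic 0, applying this to the
    powers of a nonconstant [f] in [K[W]^G], which [P] fixes, yields invariants
    of unbounded degree ([invariants_unbounded]). *)

Import GRing.Theory.

Local Open Scope ring_scope.
Local Open Scope classical_set_scope.

Lemma submm (n : nat) (m : 'X_{1..n}) : (m - m = 0)%MM.
Proof. by apply/mnmP => i; rewrite mnmBE mnm0E subnn. Qed.

Section Morphisms.
Context {K : fieldType} {A B : naAlgType K}.
Variable phi : A -> B.
Hypotheses (phiD : {morph phi : x y / x + y})
  (phiZ : forall a, {morph phi : x / a *: x})
  (phiM : {morph phi : x y / x ** y}).

Lemma naeval_morph (X : choiceType) (v : X -> A) (p : nafree K X) :
  phi (naeval v p) = naeval (phi \o v) p.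
Proof.
have phi0 : phi 0 = 0 by rewrite -(scale0r 0) phiZ scale0r.
rewrite !naevalE (big_morph phi phiD phi0); apply: eq_bigr => m _.
by rewrite phiZ; congr (_ *: _); elim: m => //= m1 <- m2 <-; rewrite phiM.
Qed.

End Morphisms.

(** * Linear substitutions in polynomials and the gradient at 0 *)

Section LinearSubstitutions.
Context {K : fieldType} {d : nat}.
Implicit Types (f p q : {mpoly K[d]}) (g : 'M[K]_d) (v : 'cV[K]_d).

Lemma linformD v w : linform (v + w) = linform v + linform w.
Proof.
by rewrite /linform -big_split; apply: eq_bigr => i _; rewrite mxE scalerDl.
Qed.

Lemma linformZ a v : linform (a *: v) = a *: linform v.
Proof.
by rewrite /linform scaler_sumr; apply: eq_bigr => i _; rewrite mxE scalerA.
Qed.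

Lemma linform0 : linform (0 : 'cV[K]_d) = 0.
Proof. by rewrite -(scale0r 0) linformZ scale0r. Qed.

Lemma linform_eval0 v : (linform v).@[fun=> 0] = 0.
Proof.
rewrite /linform raddf_sum big1 // => i _ /=.
by rewrite mevalZ mevalXU mulr0.
Qed.

Lemma linform_delta i : linform (delta_mx i 0 : 'cV[K]_d) = 'X_i.
Proof.
rewrite /linform (bigD1 i) //= big1 => [|j ji].
  by rewrite mxE !eqxx scale1r addr0.
by rewrite mxE (negPf ji) scale0r.
Qed.

Lemma meval0E p : p.@[fun=> 0] = p@_0.
Proof.
elim/mpolyind: p => [|c m p _ _ IH]; first by rewrite meval0 mcoeff0.
rewrite mevalD mcoeffD IH mevalZ mcoeffZ mevalX mcoeffX; congr (_ * _ + _).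
case: eqVneq => [->|]; first by rewrite big1 // => i _; rewrite mnm0E.
rewrite -mdeg_eq0 mdegE sum_nat_eq0 => /forallPn [i /= mi].
by rewrite (bigD1 i) //= expr0n (negPf mi) mul0r.
Qed.

Lemma mcoeff_mulXU (q : {mpoly K[d]}) i m :
  (q * 'X_i)@_m = if m i == 0%N then 0 else q@_(m - U_(i)).
Proof.
case: eqVneq => [mi|mi]; last first.
  have le : (U_(i) <= m)%MM by rewrite lep1mP.
  by rewrite -[in LHS](submK le) addmC mcoeffMX.
elim/mpolyind: q => [|c k q _ _ IH]; first by rewrite mul0r mcoeff0.
rewrite mulrDl mcoeffD IH addr0 -scalerAl -mpolyXD mcoeffZ mcoeffX.
case: eqVneq => [e|]; last by rewrite mulr0.
by move: mi; rewrite -e mnmDE mnm1E eqxx addn1.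
Qed.

Lemma poly_actD g p q : poly_act g (p + q) = poly_act g p + poly_act g q.
Proof. exact: comp_mpolyD. Qed.

Lemma poly_actB g p q : poly_act g (p - q) = poly_act g p - poly_act g q.
Proof. exact: comp_mpolyB. Qed.

Lemma poly_actM g p q : poly_act g (p * q) = poly_act g p * poly_act g q.
Proof. exact: rmorphM. Qed.

Lemma poly_actZ g a p : poly_act g (a *: p) = a *: poly_act g p.
Proof. exact: comp_mpolyZ. Qed.

Lemma poly_actC g a : poly_act g a%:MP = a%:MP.
Proof. exact: comp_mpolyC. Qed.

Lemma poly_actX g i : poly_act g 'X_i = linform (col i g).
Proof.
by rewrite /poly_act comp_mpolyXU -tnth_nth tnth_mktuple.
Qed.

Lemma poly_act_linform g v : poly_act g (linform v) = linform (g *m v).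
Proof.
rewrite /linform {1}/poly_act raddf_sum /=.
under eq_bigr do rewrite -/(poly_act _ _) poly_actZ poly_actX scaler_sumr.
rewrite exchange_big; apply: eq_bigr => i _ /=.
rewrite mxE scaler_suml; apply: eq_bigr => j _.
by rewrite !mxE scalerA mulrC.
Qed.

Lemma poly_act_eval0 g p : (poly_act g p).@[fun=> 0] = p.@[fun=> 0].
Proof.
rewrite comp_mpoly_meval; apply: meval_eq => i.
by rewrite tnth_mktuple linform_eval0.
Qed.

(** Identities between derivations, unlike those between linear maps, are checked
    on the variables only; this is the induction that does it. *)
Lemma mpoly_alg_ind (P : {mpoly K[d]} -> Prop) :
  (forall c, P c%:MP) -> (forall i, P 'X_i) ->
  (forall p q, P p -> P q -> P (p + q)) ->
  (forall p q, P p -> P q -> P (p * q)) ->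
  forall p, P p.
Proof.
move=> PC PX PD PM; elim/mpolyind => [|c m p _ _ Pp]; first exact: (PC 0).
apply: (PD) => //; rewrite -mul_mpolyC; apply: (PM) => //.
rewrite mpolyXE_id; apply: (big_rec P) => [|i q _ Pq]; first exact: (PC 1).
apply: (PM) => //; elim: (m i) => [|k IH]; first exact: (PC 1).
by rewrite exprS; apply: (PM).
Qed.

Lemma mderiv_linform v i : (linform v)^`M(i) = (v i 0)%:MP.
Proof.
rewrite /linform raddf_sum (bigD1 i) //= big1 => [|j ji] /=.
  by rewrite mderivZ mderivX mnm1E eqxx scale1r addr0 submm mpolyX0 alg_mpolyC.
by rewrite mderivZ mderivX mnm1E (negPf ji) scale0r scaler0.
Qed.

(** The chain rule for a linear substitution. *)
Lemma mderiv_poly_act g p i :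
  (poly_act g p)^`M(i) = \sum_j g i j *: poly_act g p^`M(j).
Proof.
elim/mpoly_alg_ind: p => [c|k|p q IHp IHq|p q IHp IHq].
- rewrite poly_actC mderivC big1 // => j _.
  by rewrite mderivC /poly_act comp_mpoly0 scaler0.
- rewrite poly_actX mderiv_linform mxE (bigD1 k) //= big1 => [|j jk].
    rewrite mderivX mnm1E eqxx scale1r submm mpolyX0 /poly_act comp_mpoly1.
    by rewrite addr0 alg_mpolyC.
  by rewrite mderivX mnm1E eq_sym (negPf jk) scale0r /poly_act comp_mpoly0 scaler0.
- rewrite poly_actD mderivD IHp IHq -big_split; apply: eq_bigr => j _ /=.
  by rewrite mderivD poly_actD scalerDr.
- rewrite poly_actM mderivM IHp IHq mulr_suml mulr_sumr -big_split.
  apply: eq_bigr => j _ /=.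
  by rewrite mderivM poly_actD !poly_actM scalerDr scalerAl scalerAr.
Qed.

(** The coefficients of the component of degree 1, written as derivatives
    at 0 so that the chain rule applies to them. *)
Definition grad0 p : 'cV[K]_d := \col_i (p^`M(i)).@[fun=> 0].

Lemma grad0D p q : grad0 (p + q) = grad0 p + grad0 q.
Proof. by apply/colP => i; rewrite !mxE mderivD mevalD. Qed.

Lemma grad0Z a p : grad0 (a *: p) = a *: grad0 p.
Proof. by apply/colP => i; rewrite !mxE mderivZ mevalZ. Qed.

Lemma grad0M p q : p.@[fun=> 0] = 0 -> q.@[fun=> 0] = 0 -> grad0 (p * q) = 0.
Proof.
move=> p0 q0; apply/colP => i.
by rewrite !mxE mderivM mevalD !mevalM p0 q0 mulr0 mul0r addr0.
Qed.

Lemma grad0_poly_act g p : grad0 (poly_act g p) = g *m grad0 p.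
Proof.
apply/colP => i; rewrite !mxE mderiv_poly_act raddf_sum.
by apply: eq_bigr => j _; rewrite /= mevalZ poly_act_eval0 mxE.
Qed.

Lemma grad0X i : grad0 'X_i = delta_mx i 0.
Proof.
apply/colP => j; rewrite !mxE mderivX mnm1E eqxx andbT.
case: eqVneq => [<-|ji]; last by rewrite scale0r meval0.
by rewrite scale1r submm mpolyX0 meval1.
Qed.

End LinearSubstitutions.

(** * An algebra of the variety L on the space of polynomials *)

(** A copy of the polynomial ring, to carry a product other than the usual
    one. *)
Definition linact (K : fieldType) (d : nat) := {mpoly K[d]}.

HB.instance Definition _ (K : fieldType) (d : nat) :=
  GRing.Lmodule.on (linact K d).

Section LinearAction.
Variables (K : fieldType) (d : nat).
Local Notation A := (linact K d).

(** Constants have to be removed from the left factor: otherwise a product with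
    a constant would have a nonzero linear part. *)
Definition linact_mul (p q : A) : A :=
  (p - (p.@[fun=> 0])%:MP : {mpoly K[d]}) * linform (grad0 q).

Fact linact_mulDl : left_distributive linact_mul +%R.
Proof.
move=> p q r; rewrite /linact_mul mevalD mpolyCD opprD addrACA.
exact: mulrDl.
Qed.

Fact linact_mulDr : right_distributive linact_mul +%R.
Proof. move=> p q r; rewrite /linact_mul grad0D linformD; exact: mulrDr. Qed.

Fact linact_mulZl a p q : linact_mul (a *: p) q = a *: linact_mul p q.
Proof.
rewrite /linact_mul mevalZ mpolyCM mul_mpolyC -scalerBr; exact/esym/scalerAl.
Qed.

Fact linact_mulZr a p q : linact_mul p (a *: q) = a *: linact_mul p q.
Proof. rewrite /linact_mul grad0Z linformZ; exact/esym/scalerAr. Qed.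

HB.instance Definition _ := Lmodule_isNAAlgebra.Build K A
  linact_mulDl linact_mulDr linact_mulZl linact_mulZr.

Lemma linactM (p q : A) :
  p ** q = (p - (p.@[fun=> 0])%:MP : {mpoly K[d]}) * linform (grad0 q).
Proof. by []. Qed.

Lemma linactM_eval0 (p q : A) : (p ** q).@[fun=> 0] = 0.
Proof. by rewrite linactM mevalM linform_eval0 mulr0. Qed.

Lemma grad0_linactM (p q : A) : grad0 (p ** q) = 0.
Proof.
by rewrite linactM grad0M ?linform_eval0 // mevalB mevalC subrr.
Qed.

Lemma linactMM (p q r : A) : p ** (q ** r) = 0.
Proof. by rewrite linactM grad0_linactM linform0 mulr0. Qed.

Lemma linactMC (p q r : A) : (p ** q) ** r = (p ** r) ** q.
Proof.
by rewrite linactM [RHS]linactM !linactM_eval0 !mpolyC0 !subr0 !linactM mulrAC.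
Qed.

(** Both terms of the right-symmetric identity that have the form [p ** (q ** r)]
    vanish, so the identity reduces to the commutation of right multiplications
    on products. *)
Lemma varietyL_linact : varietyL A.
Proof.
move=> p [->|->] v; rewrite /associator ?naevalB !naevalM !naeval_var !linactMM //.
by rewrite linactMC subrr.
Qed.

Lemma poly_act_linactM g (p q : A) :
  poly_act g (p ** q) = (poly_act g p : A) ** (poly_act g q : A).
Proof.
rewrite !linactM poly_actM poly_act_linform grad0_poly_act poly_actB poly_actC.
by rewrite poly_act_eval0.
Qed.

End LinearAction.

(** * Polarization in the relatively free algebra *)

Section ActionOnRelfree.
Context {K : fieldType} {d : nat} {V : naAlgType K -> Prop}.
Local Notation F := (relfree V 'I_d).
Implicit Types (x y : F) (g : 'M[K]_d).

Lemma relfree_actD g x y :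
  relfree_act g (x + y) = relfree_act g x + relfree_act g y.
Proof.
elim/relfreeW: x => p; elim/relfreeW: y => q.
by rewrite -relfree_piD !relfree_act_pi naevalD.
Qed.

Lemma relfree_actZ g a x : relfree_act g (a *: x) = a *: relfree_act g x.
Proof. by elim/relfreeW: x => p; rewrite -relfree_piZ !relfree_act_pi naevalZ. Qed.

Lemma relfree_act0 g : relfree_act g (0 : F) = 0.
Proof. by rewrite -(scale0r 0) relfree_actZ !scale0r. Qed.

Lemma relfree_actM g x y :
  relfree_act g (x ** y) = relfree_act g x ** relfree_act g y.
Proof.
elim/relfreeW: x => p; elim/relfreeW: y => q.
by rewrite -relfree_piM !relfree_act_pi naevalM.
Qed.

Lemma relfree_act_relvar g j :
  relfree_act g (relvar V j) = relfree_linform V (col j g).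
Proof. by rewrite relfree_act_pi naeval_var. Qed.

(** The recursion peels off the last letter of a word; the term of index [n] sees
    only the component of degree [n.+1] of [f], the shift being due to the
    absence of a unit in [F]. *)
Fixpoint polarize (n : nat) (f : {mpoly K[d]}) : F :=
  if n is n'.+1 then \sum_i polarize n' f^`M(i) ** relvar V i
  else relfree_linform V (grad0 f).

Lemma polarizeD n : {morph polarize n : f h / f + h}.
Proof.
elim: n => [|n IH] f h /=.
  rewrite grad0D /relfree_linform -big_split.
  by apply: eq_bigr => i _; rewrite mxE scalerDl.
by rewrite -big_split; apply: eq_bigr => i _; rewrite mderivD IH namulDl.
Qed.

Lemma polarizeZ n a : {morph polarize n : f / a *: f}.
Proof.
elim: n => [|n IH] f /=; rewrite ?grad0Z /relfree_linform scaler_sumr.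
  by apply: eq_bigr => i _; rewrite mxE scalerA.
by apply: eq_bigr => i _; rewrite mderivZ IH namulZl.
Qed.

(** The chain rule moves the entries of row [i] of [g] from the derivatives to the
    letter [x_i] that they are paired with; summing over [i] gives the images of
    the variables.  Here [g] ranges over all matrices because the lemma serves
    for a projection as well as for the group elements. *)
Lemma relfree_act_polarize g n f :
  relfree_act g (polarize n f) = polarize n (poly_act g f).
Proof.
elim: n f => [|n IH] f /=; first by rewrite relfree_act_linform grad0_poly_act.
have polarize0 : polarize n 0 = 0 by rewrite -(scale0r 0) polarizeZ scale0r.
rewrite (big_morph _ (relfree_actD g) (relfree_act0 g)).
under eq_bigr do rewrite relfree_actM IH relfree_act_relvar namul_sumr.
rewrite exchange_big; apply: eq_bigr => i _.
rewrite mderiv_poly_act (big_morph _ (polarizeD n) polarize0) namul_suml.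
by apply: eq_bigr => j _; rewrite polarizeZ mxE namulZl namulZr.
Qed.

(** The homomorphism to the polynomial algebra that sends each variable to
    itself. *)
Definition realize x : linact K d :=
  naeval (fun i => 'X_i : linact K d) (relfree_repr x).

Hypothesis VL : forall A : naAlgType K, varietyL A -> V A.

Lemma realize_pi p :
  realize (relfree_pi V p) = naeval (fun i => 'X_i : linact K d) p.
Proof. by apply: naeval_repr; apply/VL/varietyL_linact. Qed.

Lemma realizeD x y : realize (x + y) = realize x + realize y.
Proof.
elim/relfreeW: x => p; elim/relfreeW: y => q.
by rewrite -relfree_piD !realize_pi naevalD.
Qed.

Lemma realizeZ a x : realize (a *: x) = a *: realize x.
Proof. by elim/relfreeW: x => p; rewrite -relfree_piZ !realize_pi naevalZ. Qed.

Lemma realize0 : realize 0 = 0.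
Proof. by rewrite -(scale0r 0) realizeZ scale0r. Qed.

Lemma realizeM x y : realize (x ** y) = realize x ** realize y.
Proof.
elim/relfreeW: x => p; elim/relfreeW: y => q.
by rewrite -relfree_piM !realize_pi naevalM.
Qed.

Lemma realize_relvar i : realize (relvar V i) = 'X_i.
Proof. by rewrite realize_pi naeval_var. Qed.

Lemma realize_linform v : realize (relfree_linform V v) = linform v.
Proof.
rewrite /relfree_linform (big_morph _ realizeD realize0).
by apply: eq_bigr => i _; rewrite realizeZ realize_relvar.
Qed.

(** Both sides are homomorphisms from the free algebra, and they agree on the
    variables. *)
Lemma realize_act g x : realize (relfree_act g x) = poly_act g (realize x).
Proof.
elim/relfreeW: x => p; rewrite relfree_act_pi realize_pi.
rewrite (naeval_morph _ realizeD realizeZ realizeM).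
rewrite (naeval_morph (poly_act g : linact K d -> linact K d) (poly_actD g)
  (poly_actZ g) (poly_act_linactM _ _ g)).
congr (naeval _ _); apply/funext => j /=.
by rewrite realize_linform poly_actX.
Qed.

Lemma realize_polarize_eval0 n f : (realize (polarize n f)).@[fun=> 0] = 0.
Proof.
case: n => [|n] /=; first by rewrite realize_linform linform_eval0.
rewrite (big_morph _ realizeD realize0) raddf_sum big1 // => i _ /=.
by rewrite realizeM linactM_eval0.
Qed.

(** Euler's formula, iterated: each variable contributes its exponent in [m], and
    these add up to the degree of [m]. *)
Lemma mcoeff_realize_polarize n f m : mdeg m = n.+1 ->
  (realize (polarize n f))@_m = f@_m *+ (n.+1)`!.
Proof.
elim: n f m => [|n IH] f m md /=.
  have /mdeg1P [k /eqP ->] : mdeg m == 1%N by rewrite md.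
  rewrite realize_linform /linform raddf_sum (bigD1 k) //= big1 => [|j jk] /=.
    rewrite mcoeffZ mcoeffXU eqxx mulr1 addr0 mxE meval0E mcoeff_mderiv add0m.
    by rewrite mnm0E.
  by rewrite mcoeffZ mcoeffXU (negPf jk) mulr0.
rewrite (big_morph _ realizeD realize0) raddf_sum /=.
have step i : (realize (polarize n f^`M(i) ** relvar V i))@_m
            = f@_m *+ (n.+1)`! *+ m i.
  rewrite realizeM linactM realize_polarize_eval0 subr0 realize_relvar grad0X.
  rewrite linform_delta mcoeff_mulXU; case: eqVneq => [->|mi].
    by rewrite mulr0n.
  have le : (U_(i) <= m)%MM by rewrite lep1mP.
  rewrite IH; last first.
    by apply: succn_inj; rewrite -md -{2}(submK le) mdegD mdeg1 addn1.
  rewrite mcoeff_mderiv submK // mnmBE mnm1E eqxx subn1 prednK ?lt0n //.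
  by rewrite mulrnAC.
under eq_bigr do rewrite step.
by rewrite sumrMnr -mdegE md -mulrnA mulnC -factS.
Qed.
End ActionOnRelfree.

(** * Degrees of invariants *)

Section Degrees.
Context {K : fieldType} {d : nat}.
Implicit Types (G : set 'M[K]_d) (W : {vspace 'cV[K]_d}) (f : {mpoly K[d]}).

Lemma fixed_vectors_comb G (I : Type) (r : seq I) (a : I -> K)
    (u : I -> 'cV[K]_d) :
  (forall i, fixed_vectors G (u i)) ->
  fixed_vectors G (\sum_(i <- r) a i *: u i).
Proof.
move=> fu g Gg; rewrite mulmx_sumr; apply: eq_bigr => i _.
by rewrite -scalemxAr fu.
Qed.

(** The columns of [P] are components in [W] of the basis vectors; any choice of
    them gives the projection, since the sum is direct. *)
Lemma complement_projection G W : complement_of_fixed G W ->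
  exists P : 'M[K]_d, (forall w, w \in W -> P *m w = w) /\
                      (forall u, fixed_vectors G u -> P *m u = 0).
Proof.
move=> [dec cap].
have uniq0 v : fixed_vectors G v -> v \in W -> v = 0.
  by move=> fv Wv; have : (fixed_vectors G `&` [set` W]) v by []; rewrite cap.
have decb j : exists w, w \in W /\ fixed_vectors G (delta_mx j 0 - w).
  have [u [w [fu Ww e]]] := dec (delta_mx j 0).
  by exists w; split=> //; rewrite e addrK.
have [w decw] := choice decb.
pose P : 'M[K]_d := \matrix_(i, j) w j i 0.
have PE v : P *m v = \sum_j v j 0 *: w j.
  by apply/colP => i; rewrite !mxE summxE; apply: eq_bigr => j _; rewrite !mxE mulrC.
have PW v : P *m v \in W.
  by rewrite PE; apply: memv_suml => j _; apply/memvZ; case: (decw j).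
have Pfix v : fixed_vectors G (v - P *m v).
  have -> : v - P *m v = \sum_j v j 0 *: (delta_mx j 0 - w j).
    under eq_bigr do rewrite scalerBr.
    rewrite sumrB -PE {1}[v]matrix_sum_delta; congr (_ - _).
    by apply: eq_bigr => j _; rewrite big_ord1.
  by apply: fixed_vectors_comb => j; case: (decw j).
exists P; split=> v hv.
  by apply/esym/eqP; rewrite -subr_eq0; apply/eqP/uniq0 => //; rewrite memvB.
apply: uniq0 => // g Gg; rewrite -[P *m v](subKr v) mulmxBr (hv g Gg).
by rewrite (Pfix v g Gg).
Qed.

(** The substitution by [P] is an algebra endomorphism fixing the generators of
    [K[W]]. *)
Lemma poly_act_algebra (P : 'M[K]_d) W f :
  (forall w, w \in W -> P *m w = w) -> poly_algebra W f -> poly_act P f = f.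
Proof.
move=> PW Wf; apply: (Wf [set p | poly_act P p = p]) => [|_ [w Ww <-]] /=.
  split=> [|p q|a p|p q] /=.
  - exact: (poly_actC P 1).
  - by rewrite poly_actD => -> ->.
  - by rewrite poly_actZ => ->.
  - by rewrite poly_actM => -> ->.
by rewrite poly_act_linform PW.
Qed.

Lemma poly_invariantsC G W c : poly_invariants G W c%:MP.
Proof.
split=> [B [B1 _ BZ _] _|g _]; last exact: poly_actC.
by rewrite -alg_mpolyC; apply: BZ.
Qed.

Lemma poly_invariantsX G W f k :
  poly_invariants G W f -> poly_invariants G W (f ^+ k).
Proof.
move=> [Wf Gf]; elim: k => [|k [IHW IHG]].
  by rewrite expr0 -mpolyC1; apply: poly_invariantsC.
split=> [B sB lB|g Gg]; rewrite exprS; last by rewrite poly_actM Gf ?IHG.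
by case: (sB) => _ _ _; apply; [apply: Wf | apply: IHW].
Qed.

Lemma nonconstant_invariant G W :
  poly_invariants G W <> range (@mpolyC d K) ->
  exists2 f, poly_invariants G W f & (1 < msize f)%N.
Proof.
move=> ne; apply: contrapT => no; apply: ne; apply/seteqP; split=> f.
  move=> If; exists f@_0 => //; apply/esym/msize1_polyC.
  by rewrite leqNgt; apply/negP => lt; apply: no; exists f.
by move=> [c _ <-]; apply: poly_invariantsC.
Qed.

Variable V : naAlgType K -> Prop.
Hypothesis VL : forall A : naAlgType K, varietyL A -> V A.
Local Notation F := (relfree V 'I_d).

(** The linear part depends equivariantly on [x]. *)
Lemma fixed_grad0_realize G (x : F) :
  relfree_invariants V G x -> fixed_vectors G (grad0 (realize x)).
Proof. by move=> Ix g Gg; rewrite -grad0_poly_act -realize_act // Ix. Qed.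

(** The invariants whose image under [P] has degree at most that of the
    generators form a subalgebra, because products of invariants are sent
    to 0. *)
Lemma fg_invariants_bounded G (P : 'M[K]_d) :
  (forall u, fixed_vectors G u -> P *m u = 0) ->
  na_finitely_generated (relfree_invariants V G) ->
  exists N, forall x, relfree_invariants V G x ->
    (msize (poly_act P (realize x)) <= N)%N.
Proof.
move=> P0 [s sE]; pose h (x : F) := msize (poly_act P (realize x)).
exists (\max_(y <- s) h y)%N => x; rewrite {1}sE => gx.
set N := (\max_(y <- s) h y)%N.
pose B := [set y | relfree_invariants V G y /\ (h y <= N)%N].
suff [] : B x by [].
apply: gx => [|y sy]; last first.
  split; first by rewrite sE => C _; apply.
  by rewrite /N (big_rem y) //= leq_maxl.
split=> [|y z [Iy hy] [Iz hz]|a y [Iy hy]|y z [Iy hy] [Iz hz]]; split.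
- by move=> g _; rewrite relfree_act0.
- by rewrite /h realize0 // /poly_act comp_mpoly0 msize0.
- by move=> g Gg; rewrite relfree_actD Iy ?Iz.
- rewrite /h realizeD // poly_actD (leq_trans (msizeD_le _ _)) //.
  by rewrite geq_max hy.
- by move=> g Gg; rewrite relfree_actZ Iy.
- by rewrite /h realizeZ // poly_actZ (leq_trans (msizeZ_le _ _)).
- by move=> g Gg; rewrite relfree_actM Iy ?Iz.
rewrite /h realizeM // linactM poly_actM poly_act_linform P0.
  by rewrite linform0 mulr0 msize0.
exact: fixed_grad0_realize.
Qed.

(** Polarize [f ^+ N.+1] in its top degree, which is at least [N.+1]. *)
Lemma invariants_unbounded G W (P : 'M[K]_d) f N :
  [pchar K] =i pred0 ->
  (forall w, w \in W -> P *m w = w) ->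
  poly_invariants G W f -> (1 < msize f)%N ->
  exists2 x, relfree_invariants V G x &
    (N < msize (poly_act P (realize x)))%N.
Proof.
move=> charK PW If f1.
have f0 : f != 0 by rewrite -msize_poly_eq0 -lt0n ltnW.
pose h := f ^+ N.+1; pose m := mlead h.
have Ih : poly_invariants G W h by apply: poly_invariantsX.
have h0 : h != 0 by rewrite expf_neq0.
have hm : h@_m != 0 by rewrite mleadc_eq0.
have md : (N < mdeg m)%N.
  by rewrite /m mleadX // mdegMn leq_pmull // -ltnS mlead_deg.
have mdE : mdeg m = (mdeg m).-1.+1 by rewrite prednK // (leq_ltn_trans _ md).
exists (polarize (mdeg m).-1 h).
  by move=> g Gg; rewrite relfree_act_polarize Ih.2.
rewrite -realize_act // relfree_act_polarize (poly_act_algebra _ _ _ PW Ih.1).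
apply: (ltn_trans md); apply: msize_mdeg_lt.
rewrite mcoeff_msupp mcoeff_realize_polarize // -mulr_natr mulf_neq0 //.
by rewrite (pcharf0P _).1 // -lt0n fact_gt0.
Qed.
End Degrees.

Theorem proposition3p3 (K : fieldType) (charK : [pchar K] =i pred0)
    (d : nat) (d_ge2 : (2 <= d)%N) (G : set 'M[K]_d) (W : {vspace 'cV[K]_d}) :
  reductive G ->
  submodule G W ->
  complement_of_fixed G W ->
  poly_invariants G W <> range (@mpolyC d K) ->
  forall V : naAlgType K -> Prop,
    is_variety V ->
    (forall A : naAlgType K, varietyL A -> V A) ->
    ~ na_finitely_generated (relfree_invariants V G).
Proof.
move=> _ _ compl ne V _ VL fg.
have [P [PW P0]] := complement_projection _ _ compl.
have [N bound] := fg_invariants_bounded V VL _ _ P0 fg.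
have [f If f1] := nonconstant_invariant _ _ ne.
have [x Ix] := invariants_unbounded V VL G W P f N charK PW If f1.
by rewrite ltnNge bound.
Qed.
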